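(* Let $G$ be a finite simple graph on $n\ge 3$ vertices. Then $$\ell(I_c(G))=\ell(I(G))=n-b(G).$$
   Context: Let $K$ be a field, let $G$ be a finite simple graph with vertex set $[n]=\{1,\dots,n\}$ and edge set $E(G)$, and let $S=K[x_1,\dots,x_n]$ and $\mathfrak{m}=(x_1,\dots,x_n)$. The edge ideal of $G$ is $I(G)=(x_ix_j:\{i,j\}\in E(G))$ and the complementary edge ideal of $G$ is $I_c(G)=((x_1\cdots x_n)/(x_ix_j):\{i,j\}\in E(G))$. The analytic spread $\ell(I)$ of an ideal $I\subset S$ is the Krull dimension of its fiber cone $\mathcal{R}(I)/\mathfrak{m}\mathcal{R}(I)$, where $\mathcal{R}(I)=\bigoplus_{k\ge0}I^kt^k$ is the Rees algebra of $I$. The number $b(G)$ is the number of bipartite connected components of $G$, where an isolated vertex of $G$ is regarded as a bipartite connected component. *)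

(* Defs.v *)
From HB Require Import structures.
From mathcomp Require Import all_boot all_algebra.
From mathcomp Require Export mpoly.
From mathcomp Require Import boolp.
From mathcomp Require Export constructive_ereal.

Set Implicit Arguments.
Unset Strict Implicit.
Unset Printing Implicit Defensive.

Import GRing.Theory.
Local Open Scope ring_scope.

(* Subsets of a ring are boolean predicates; the asbool brackets turn a       *)
(* proposition into a boolean, classically.                                   *)
Section Ideals.
Variable R : comNzRingType.
Implicit Types (A I J : {pred R}) (x y a : R).

Definition gen_ideal A : {pred R} := fun x =>
  `[< exists s : seq (R * R),
        {in s, forall p, p.2 \in A} /\ x = \sum_(p <- s) p.1 * p.2 >].

Definition ideal_mul I J : {pred R} :=
  gen_ideal (fun x => `[< exists2 a, a \in I & exists2 b, b \in J & x = a * b >]).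

Fixpoint ideal_exp I (k : nat) : {pred R} :=
  if k is k'.+1 then ideal_mul I (ideal_exp I k') else predT.

Lemma gen_idealP A x :
  reflect (exists s : seq (R * R),
             {in s, forall p, p.2 \in A} /\ x = \sum_(p <- s) p.1 * p.2)
          (x \in gen_ideal A).
Proof. exact: asboolP. Qed.

Lemma mem_gen_ideal A x : x \in A -> x \in gen_ideal A.
Proof.
move=> Ax; apply/gen_idealP; exists [:: (1, x)]; split.
  by move=> p; rewrite inE => /eqP->.
by rewrite big_seq1 mul1r.
Qed.

Lemma gen_ideal0 A : 0 \in gen_ideal A.
Proof. by apply/gen_idealP; exists [::]; split=> //; rewrite big_nil. Qed.

Lemma gen_idealD A x y :
  x \in gen_ideal A -> y \in gen_ideal A -> x + y \in gen_ideal A.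
Proof.
move=> /gen_idealP[s [sA ->]] /gen_idealP[t [tA ->]].
apply/gen_idealP; exists (s ++ t); split; last by rewrite big_cat.
by move=> p; rewrite mem_cat => /orP[/sA|/tA].
Qed.

Lemma gen_idealM A a x : x \in gen_ideal A -> a * x \in gen_ideal A.
Proof.
move=> /gen_idealP[s [sA ->]]; apply/gen_idealP.
exists [seq (a * p.1, p.2) | p <- s]; split.
  by move=> _ /mapP[p ps ->]; apply: (sA p ps).
by rewrite big_map mulr_sumr; apply: eq_bigr => p _ /=; rewrite mulrA.
Qed.

Lemma gen_ideal_sub A (B : R -> Prop) :
    B 0 -> (forall x y, B x -> B y -> B (x + y)) ->
    (forall a x, B x -> B (a * x)) -> (forall x, x \in A -> B x) ->
  forall x, x \in gen_ideal A -> B x.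
Proof.
move=> B0 BD BM AB x /gen_idealP[s [sA ->]].
by rewrite big_seq; apply: big_ind => // p /sA/AB; apply: BM.
Qed.

Lemma ideal_exp0 I k : 0 \in ideal_exp I k.
Proof. by case: k => //= k; apply: gen_ideal0. Qed.

Lemma ideal_expD I k x y :
  x \in ideal_exp I k -> y \in ideal_exp I k -> x + y \in ideal_exp I k.
Proof. by case: k => //= k; apply: gen_idealD. Qed.

Lemma ideal_expMl I k a x : x \in ideal_exp I k -> a * x \in ideal_exp I k.
Proof. by case: k => //= k; apply: gen_idealM. Qed.

Lemma ideal_expM I i j x y :
  x \in ideal_exp I i -> y \in ideal_exp I j -> x * y \in ideal_exp I (i + j).
Proof.
elim: i x => [|i IHi] x; first by move=> _; apply: ideal_expMl.
move=> xI yI; move: x xI; rewrite addSn /=.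
apply: gen_ideal_sub => [|u v|a u|u].
- by rewrite mul0r gen_ideal0.
- by rewrite mulrDl; apply: gen_idealD.
- by rewrite -mulrA; apply: gen_idealM.
move=> /asboolP[a aI [b bI ->]]; apply: mem_gen_ideal; apply/asboolP.
by exists a => //; exists (b * y); [apply: IHi | rewrite mulrA].
Qed.

End Ideals.

(* The indeterminate t of R[t] is 'X, so that the Rees algebra consists of    *)
(* the polynomials whose coefficient of t^k lies in I^k.                      *)
Section Rees.
Variables (R : comNzRingType) (I : {pred R}).

Definition rees_pred : {pred {poly R}} :=
  fun p => `[< forall k, p`_k \in ideal_exp I k >].

Lemma rees_subring : subring_closed rees_pred.
Proof.
split=> [|p q /asboolP pI /asboolP qI|p q /asboolP pI /asboolP qI];
  apply/asboolP => k.
- by rewrite coef1; case: k => [|k] //=; apply: gen_ideal0.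
- by rewrite coefB; apply: ideal_expD => //; rewrite -mulN1r; apply: ideal_expMl.
rewrite coefM; apply: (big_ind (fun x => x \in ideal_exp I k)) => [|x y|i _].
- exact: ideal_exp0.
- exact: ideal_expD.
by rewrite -[X in ideal_exp I X](subnKC (leq_ord i)); apply: ideal_expM.
Qed.

HB.instance Definition _ := GRing.isSubringClosed.Build {poly R} rees_pred rees_subring.

Record rees := Rees { rees_val : {poly R}; _ : rees_val \in rees_pred }.

HB.instance Definition _ := [isSub for rees_val].
HB.instance Definition _ := [Choice of rees by <:].
HB.instance Definition _ := [SubChoice_isSubComNzRing of rees by <:].

Definition rees_extend (J : {pred R}) : {pred rees} :=
  gen_ideal (fun f : rees => `[< exists2 a, a \in J & val f = a%:P >]).

End Rees.

Section KrullDim.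
Variable R : comNzRingType.

Definition is_prime_ideal (P : {pred R}) :=
  idealr_closed P /\ prime_idealr_closed P.

(* A chain of length d consists of d + 1 primes.                              *)
Definition prime_chain (d : nat) (P : 'I_d.+1 -> {pred R}) :=
  (forall i, is_prime_ideal (P i)) /\
  (forall i j : 'I_d.+1, (i < j)%N ->
     {subset P i <= P j} /\ exists2 x, x \in P j & x \notin P i).

Definition has_prime_chain (d : nat) := exists P, @prime_chain d P.

Definition max_chain_length (d : nat) :=
  has_prime_chain d /\ forall d', has_prime_chain d' -> (d' <= d)%N.

(* R is nonzero, hence has a prime ideal: if no maximal length exists, the    *)
(* lengths are unbounded.                                                     *)
Definition krull_dim : \bar nat :=
  match pselect (exists d, max_chain_length d) with
  | left ex_d => (projT1 (cid ex_d))%:E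
  | right _ => +oo%E
  end.

End KrullDim.

Section AnalyticSpread.
Variables (K : fieldType) (n : nat).
Implicit Type I : {pred {mpoly K[n]}}.

Definition irrelevant_ideal : {pred {mpoly K[n]}} :=
  gen_ideal [pred x : {mpoly K[n]} | [exists i, x == 'X_i]].

Definition fiber_ideal I : {pred rees I} := rees_extend irrelevant_ideal.

Lemma irrelevant_coef0 x : x \in irrelevant_ideal -> x@_0%MM = 0.
Proof.
move: x; apply: gen_ideal_sub => [|x y x0 y0|a x x0|x].
- exact: mcoeff0.
- by rewrite mcoeffD x0 y0 addr0.
- by rewrite (rmorphM (mcoeff 0%MM)) /= x0 mulr0.
by case/existsP=> i /eqP->; rewrite mcoeffX mnm1_eq0.
Qed.

Lemma fiber_ideal_closed I : idealr_closed (@fiber_ideal I).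
Proof.
split=> [||a x y xI yI]; first exact: gen_ideal0; last first.
  by apply: gen_idealD => //; apply: gen_idealM.
suff coef0 (f : rees I) : f \in @fiber_ideal I -> ((val f)`_0)@_0%MM = 0.
  by apply/negP => /coef0/eqP; rewrite rmorph1 coef1 /= mcoeff1 eqxx oner_eq0.
move: f; apply: gen_ideal_sub => [|f g f0 g0|h f f0|f].
- by rewrite rmorph0 coef0 mcoeff0.
- by rewrite rmorphD coefD mcoeffD f0 g0 addr0.
- rewrite rmorphM coefM big_ord1 (rmorphM (mcoeff 0%MM)) /=.
  by rewrite subnn f0 mulr0.
by move=> /asboolP[a aI ->]; rewrite coefC eqxx irrelevant_coef0.
Qed.

HB.instance Definition _ I :=
  isIdealr.Build (rees I) (@fiber_ideal I) (@fiber_ideal_closed I).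

Definition fiber_cone I := {ideal_quot (@fiber_ideal I)}.
HB.instance Definition _ I := GRing.ComNzRing.on (fiber_cone I).

Definition analytic_spread I : \bar nat := krull_dim (fiber_cone I).

End AnalyticSpread.

(* A simple graph on [n] is a symmetric irreflexive relation on 'I_n.         *)
Section Graph.
Variables (K : fieldType) (n : nat) (e : rel 'I_n).

Definition edge_ideal : {pred {mpoly K[n]}} :=
  gen_ideal [pred x : {mpoly K[n]} |
    [exists i, exists j, e i j && (x == 'X_i * 'X_j)]].

Definition comp_edge_ideal : {pred {mpoly K[n]}} :=
  gen_ideal [pred x : {mpoly K[n]} |
    [exists i, exists j, e i j && (x == \prod_(k | (k != i) && (k != j)) 'X_k)]].

Definition components : {set {set 'I_n}} :=
  equivalence_partition (connect e) [set: 'I_n].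

Definition bipartite_on (C : {set 'I_n}) : bool :=
  [exists A : {set 'I_n},
    [forall i in C, forall j in C, e i j ==> ((i \in A) != (j \in A))]].

Definition nb_bipartite_components : nat :=
  #|[set C in components | bipartite_on C]|.

End Graph.

Arguments edge_ideal K [n] e.
Arguments comp_edge_ideal K [n] e.

(* Main.v *)
From HB Require Import structures.
Require Import Defs.
From mathcomp Require Import all_boot all_order all_algebra.
From mathcomp Require Import boolp.

Set Implicit Arguments.
Unset Strict Implicit.
Unset Printing Implicit Defensive.

Import Order.TTheory GRing.Theory Num.Theory.
Local Open Scope ring_scope.
Local Open Scope quotient_scope.

(** Let I be generated by monomials X^(v_i), all of degree d > 0. Modulo the
    irrelevant ideal only the lowest component of I^k, of degree dk, survives in
    degree k of the Rees algebra, so the fiber cone is isomorphic to the monomial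
    algebra K[X^(v_i)]. Its Krull dimension is the rank over the rationals of the
    matrix M with rows v_i ([analytic_spread_monomial]).

    To see this, choose rank M columns of M spanning the column space and set
    the other variables to 1. Rows of M are determined by the chosen columns, so
    distinct monomials of the algebra stay distinct, and the fiber cone embeds
    into a polynomial ring in r = rank M variables ([fiber_morph_ker]).

    The dimension is at most r because any r + 1 elements of the fiber cone are
    algebraically dependent, by counting monomials ([mpoly_alg_dependent]),
    whereas elements x_i of P_(i+1) outside P_i, for a chain of primes P_i, are
    algebraically independent ([prime_chain_independent]).

    It is at least r because setting the r variables to 1 one after the other
    gives a chain of r + 1 kernels of morphisms to a domain. Each inclusion is
    strict: since the chosen columns are independent, some integral combination
    of the v_i is zero in all of them but a prescribed one, and splitting it into
    positive and negative parts gives two monomials whose difference lies in one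
    kernel and not in the previous one ([prime_chain_keep]).

    Both ideals of the theorem are of this kind. The exponent matrix of the
    complementary edge ideal is obtained from the incidence matrix of G by
    subtracting it from the all-one matrix; as the rows of each matrix have
    constant sum, 2 and n - 2, each matrix is a right multiple of the other, and
    the ranks agree ([rank_comp_edge]). The incidence matrix has rank n - b(G),
    since its columns outside a system of representatives of the bipartite
    components are independent, and determine all rows: on a bipartite component
    every row has zero alternating sum ([rank_edge]). *)

(** * Elements along a chain of primes *)

Section Chains.
Variable A : comNzRingType.

Section PrimeIdeal.
Variables (P : {pred A}) (primeP : is_prime_ideal P).

Lemma prime_ideal0 : 0 \in P.
Proof. by case: primeP => [[]]. Qed.

Lemma prime_idealD x y : x \in P -> y \in P -> x + y \in P.
Proof. by case: primeP => [[_ _ clP] _] xP yP; rewrite -[x]mul1r clP. Qed.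

Lemma prime_idealMl a x : x \in P -> a * x \in P.
Proof.
by case: primeP => [[P0 _ clP] _] xP; rewrite -[_ * _]addr0 clP.
Qed.

Lemma prime_idealBl x y : x \in P -> x + y \in P -> y \in P.
Proof.
move=> xP xyP; rewrite -[y](addKr x) -mulN1r.
by rewrite prime_idealD ?prime_idealMl.
Qed.

Lemma prime_ideal_sum (I : finType) (S : pred I) (F : I -> A) :
  (forall i, S i -> F i \in P) -> \sum_(i | S i) F i \in P.
Proof.
move=> FP; apply: (big_ind (fun x => x \in P)) => //.
- exact: prime_ideal0.
- exact: prime_idealD.
Qed.

Lemma prime_ideal_unit a b : b * a = 1 -> a \notin P.
Proof.
move=> ba1; apply/negP => /(prime_idealMl b); rewrite ba1.
by case: primeP => [[_ /negP]].
Qed.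

Lemma prime_ideal_cancelX x y k : x \notin P -> x ^+ k * y \in P -> y \in P.
Proof.
move=> xP; elim: k => [|k IHk]; first by rewrite mul1r.
rewrite exprS -mulrA; case: primeP => [_ prP] /prP.
by rewrite (negPf xP) /= => /IHk.
Qed.

End PrimeIdeal.

(** Take x_i in P_(i+1) outside P_i. In a relation among the x_i, cancel the
    largest power of x_0 that divides all its terms, as the prime P_0 allows,
    and drop the terms still divisible by x_0, which lie in P_1: what is left is
    a relation modulo P_1 among the other x_i. Repeating this until all variables
    are gone leaves one coefficient in the last prime, so it cannot be
    invertible. The hypothesis on the coefficients c lets them range over the
    image of a field. *)
Lemma prime_chain_independent N (P : 'I_N.+1 -> {pred A}) :
    prime_chain P ->
  exists x : 'I_N -> A, forall D (c : {ffun 'I_N -> 'I_D} -> A),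
    (forall a, c a = 0 \/ exists b, b * c a = 1) ->
    \sum_a c a * \prod_i x i ^+ a i = 0 -> forall a, c a = 0.
Proof.
case=> primeP chainP.
have step (i : 'I_N) : exists y,
    y \in P (inord i.+1) /\ y \notin P (inord i).
  have lti: ((inord i : 'I_N.+1) < (inord i.+1 : 'I_N.+1))%N.
    by rewrite !inordK // ltnS // ltnW.
  by have [_ [y yP yNP]] := chainP _ _ lti; exists y.
have [x xP] := choice step; exists x => D c cunit rel0 a1.
have [//|/eqP ca1] := eqVneq (c a1) 0; exfalso.
(* S is the set of terms left once x_0, ..., x_(j-1) have been eliminated; the
   exponents of these variables are the same in all of them. *)
have claim j : (j <= N)%N -> exists S : {set {ffun 'I_N -> 'I_D}},
  [/\ S != set0, {in S, forall a, c a != 0},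
      {in S &, forall (a b : {ffun 'I_N -> 'I_D}) (i : 'I_N),
          (i < j)%N -> a i = b i} &
      \sum_(a in S) c a * \prod_(i : 'I_N | (j <= i)%N) x i ^+ a i \in P (inord j)].
  elim: j => [|j IHj] ltjN.
    exists [set a | c a != 0]; split=> [|a|//|].
    - by apply/set0Pn; exists a1; rewrite inE; apply/eqP.
    - by rewrite inE.
    - suff ->: \sum_(a in [set a | c a != 0]) c a
                 * \prod_(i : 'I_N | (0 <= i)%N) x i ^+ a i = 0.
        exact: prime_ideal0.
      rewrite -[RHS]rel0 [RHS](bigID [pred a | c a == 0]) /=.
      rewrite [X in _ = X + _]big1 ?add0r => [|a /eqP->]; last by rewrite mul0r.
      by apply: eq_bigl => a; rewrite inE.
  have [S [/set0Pn[a0 Sa0] cS eqS sumS]] := IHj (ltnW ltjN).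
  pose J := Ordinal ltjN.
  case: (arg_minnP (fun a : {ffun 'I_N -> 'I_D} => a J : nat) Sa0) => m /= Sm minm.
  have {}Sm : m \in S by [].
  have {}minm a : a \in S -> (m J <= a J)%N by exact: minm.
  exists [set a in S | a J == m J]; split.
  - by apply/set0Pn; exists m; rewrite inE Sm /=.
  - by move=> a; rewrite inE => /andP[/cS].
  - move=> a b; rewrite !inE => /andP[Sa /eqP aJ] /andP[Sb /eqP bJ] i.
    rewrite ltnS leq_eqVlt => /orP[/eqP ij|]; last exact: eqS.
    by have ->: i = J; [apply: val_inj | rewrite aJ bJ].
  have [xJ xNJ] := xP J.
  (* The terms of S without x_J, and without the variables before it. *)
  pose F a := c a * \prod_(i : 'I_N | (j < i)%N) x i ^+ a i.
  have inj : ((inord j : 'I_N.+1) < (inord j.+1 : 'I_N.+1))%N.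
    by rewrite !inordK // ltnS // ltnW.
  have [subP _] := chainP _ _ inj.
  have: \sum_(a in S) x J ^+ (a J - m J) * F a \in P (inord j.+1).
    apply/subP/(prime_ideal_cancelX (k := m J) (primeP _) xNJ).
    rewrite mulr_sumr; congr (_ \in P _): sumS; apply: eq_bigr => a Sa.
    rewrite mulrA -exprD subnKC ?minm // (bigD1 J) //= mulrCA; congr (_ * (_ * _)).
    by apply: eq_bigl => i; rewrite [RHS]ltn_neqAle andbC eq_sym -(inj_eq val_inj).
  rewrite (bigID [pred a : {ffun 'I_N -> 'I_D} | a J == m J]) /= addrC.
  move=> sumP; have: \sum_(a in S | a J != m J) x J ^+ (a J - m J) * F a
                       \in P (inord j.+1).
    apply: (prime_ideal_sum (primeP _)) => a /andP[Sa aJ].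
    rewrite -(prednK (n := a J - m J)) ?exprS -?mulrA.
      by rewrite mulrC prime_idealMl.
    by rewrite subn_gt0 ltn_neqAle minm // eq_sym aJ.
  move/(prime_idealBl (primeP _))/(_ sumP); congr (_ \in P _).
  apply: eq_big => a; first by rewrite inE.
  by case/andP=> _ /eqP->; rewrite subnn mul1r.
have [S [/set0Pn[a Sa] cS eqS]] := claim N (leqnn N).
have ->: S = [set a].
  apply/setP=> b; rewrite inE; apply/idP/eqP => [Sb|->//].
  by apply/ffunP => i; apply: eqS.
rewrite big_set1 big_pred0 => [|i]; last by rewrite leqNgt ltn_ord.
rewrite mulr1; apply/negP; case: (cunit a) => [ca0|[b /prime_ideal_unit]].
  by have := cS _ Sa; rewrite ca0 eqxx.
exact.
Qed.

End Chains.

(** * Algebraic dependence by counting monomials *)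

Section Dependence.
Variable K : fieldType.

Definition mdeg_le n b (p : {mpoly K[n]}) := forall m, m \in msupp p -> (mdeg m <= b)%N.

Lemma mdeg_leM n b1 b2 (p q : {mpoly K[n]}) :
  mdeg_le b1 p -> mdeg_le b2 q -> mdeg_le (b1 + b2) (p * q).
Proof.
move=> hp hq m /msuppM_le/allpairsP[[m1 m2] /= [/hp h1 /hq h2 ->]].
by rewrite mdegD leq_add.
Qed.

Lemma mdeg_le1 n : mdeg_le 0 (1 : {mpoly K[n]}).
Proof. by move=> m; rewrite msupp1 inE => /eqP->; rewrite mdeg0. Qed.

Lemma mdeg_leX n b k (p : {mpoly K[n]}) : mdeg_le b p -> mdeg_le (k * b) (p ^+ k).
Proof.
move=> hp; elim: k => [|k IHk]; first exact: mdeg_le1.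
by rewrite exprS mulSn; apply: mdeg_leM.
Qed.

Lemma mdeg_le_prod n (I : finType) (b : I -> nat) (p : I -> {mpoly K[n]}) :
  (forall i, mdeg_le (b i) (p i)) -> mdeg_le (\sum_i b i) (\prod_i p i).
Proof.
move=> hp; elim/big_ind2: _ => [|????|i _]; [exact: mdeg_le1 | exact: mdeg_leM |].
exact: hp.
Qed.

(** There are at most (b + 1)^n monomials of degree at most b, as each exponent
    is at most b. *)
Lemma mpoly_lin_dependent n (T : finType) b (p : T -> {mpoly K[n]}) :
    (forall t, mdeg_le b (p t)) -> (b.+1 ^ n < #|T|)%N ->
  exists2 c : T -> K, (exists t, c t != 0) & \sum_t c t *: p t = 0.
Proof.
move=> hp ltT; pose B := {ffun 'I_n -> 'I_b.+1}.
pose M : 'M[K]_(#|T|, #|B|) := \matrix_(i, j)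
  (p (enum_val i))@_[multinom ((enum_val j : B) k : nat) | k < n].
have /rowV0Pn[u /sub_kermxP uM u0] : kermx M != 0.
  rewrite -mxrank_eq0 mxrank_ker -lt0n subn_gt0 (leq_ltn_trans (rank_leq_col _)) //.
  by rewrite card_ffun !card_ord.
exists (fun t => u 0 (enum_rank t)).
  have [i ui] : exists i, u 0 i != 0 by apply/rV0Pn.
  by exists (enum_val i); rewrite enum_valK.
apply/mpolyP => m; rewrite mcoeff0 raddf_sum /=.
have [ltm|gtm] := boolP [forall k, (m k <= b)%N]; last first.
  rewrite big1 // => t _; rewrite mcoeffZ memN_msupp_eq0 ?mulr0 //.
  apply: contra gtm => /hp lem; apply/forallP => k; apply: leq_trans lem.
  by rewrite mdegE (bigD1 k) //= leq_addr.
pose a : B := [ffun k => inord (m k)].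
have := congr1 (fun v : 'rV_ _ => v 0 (enum_rank a)) uM; rewrite !mxE => uM0.
rewrite -[RHS]uM0 [RHS](reindex enum_rank) /=; last exact/onW_bij/enum_rank_bij.
apply: eq_bigr => t _; rewrite mcoeffZ !mxE !enum_rankK; congr (_ * _@__).
by apply/mnmP => k; rewrite mnmE ffunE inordK // ltnS (forallP ltm).
Qed.

(** If the y_i have degree at most w, the D^N products of their powers with
    exponents below D have degree less than D(Nw + 1), so they live in a space
    of dimension at most D^n (Nw + 1)^n, which is smaller than D^N as soon as
    N > n and D > (Nw + 1)^n. *)
Lemma mpoly_alg_dependent n N (y : 'I_N -> {mpoly K[n]}) : (n < N)%N ->
  exists D (c : {ffun 'I_N -> 'I_D} -> K),
    (exists a, c a != 0) /\ \sum_a c a *: \prod_i y i ^+ a i = 0.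
Proof.
move=> ltnN; pose w := \max_i msize (y i).
have yw i : mdeg_le w (y i).
  by move=> m /msize_mdeg_lt/ltnW/leq_trans-> //; apply: leq_bigmax.
pose D := ((N * w).+1 ^ n).+1.
exists D; have [||c] := @mpoly_lin_dependent n {ffun 'I_N -> 'I_D} (D.-1 * (N * w))
  (fun a => \prod_i y i ^+ a i); last by exists c.
  move=> a m /(mdeg_le_prod (fun i => mdeg_leX (k := a i) (yw i))) /leq_trans-> //.
  rewrite -big_distrl /= mulnA leq_mul2r.
  apply/orP; right; have -> : (D.-1 * N = \sum_(i < N) D.-1)%N.
    by rewrite sum_nat_const card_ord mulnC.
  by apply: leq_sum => i _; rewrite -ltnS ltn_ord.
rewrite card_ffun !card_ord; apply: leq_ltn_trans (_ : (D * (N * w).+1) ^ n < _)%N.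
  case: (n) => [//|n']; rewrite leq_exp2r // mulnS -add1n leq_add //.
  by rewrite leq_mul2r leq_pred orbT.
apply: leq_trans (_ : D ^ n.+1 <= _)%N; last by rewrite leq_pexp2l.
by rewrite expnMn expnS mulnC ltn_pmul2r ?expn_gt0.
Qed.

End Dependence.

(** * Krull dimension of a subalgebra of a polynomial ring *)

Lemma max_chain_length_uniq (A : comNzRingType) d d' :
  max_chain_length A d -> max_chain_length A d' -> d = d'.
Proof.
by move=> [cd maxd] [cd' maxd']; apply/eqP; rewrite eqn_leq maxd // maxd'.
Qed.

Lemma krull_dimE (A : comNzRingType) d : max_chain_length A d -> krull_dim A = d%:E.
Proof.
move=> maxd; rewrite /krull_dim; case: pselect => [ex_d|[]]; last by exists d.
by congr _%:E; apply: max_chain_length_uniq maxd; case: (cid ex_d).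
Qed.

(** The endomorphism that sets to 1 all variables but the first s. *)
Notation keep K r s := (mmap (@mpolyC r K)
  (fun j : 'I_r => if (j < s)%N then 'X_j else 1 : {mpoly K[r]})).

Section Retraction.
Variables (K : fieldType) (r : nat).

Definition keep_mnm s (w : 'X_{1..r}) : 'X_{1..r} :=
  [multinom if (j < s)%N then w j else 0%N | j < r].

Lemma keepX s w : keep K r s 'X_[w] = 'X_[keep_mnm s w].
Proof.
rewrite mmapX /mmap1 [RHS]mpolyXE_id; apply: eq_bigr => j _.
by rewrite mnmE; case: ifP => // _; rewrite expr1n.
Qed.

Lemma keep_keep s t p : (s <= t)%N -> keep K r s (keep K r t p) = keep K r s p.
Proof.
move=> le_st; elim/mpolyind: p => [|c w p _ _ IHp]; first by rewrite !rmorph0.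
rewrite !rmorphD /= {}IHp !mmapZ !mul_mpolyC mmapZ mul_mpolyC !keepX.
congr (_ *: 'X_[_] + _); apply/mnmP => j; rewrite !mnmE.
by case: ifP => // /leq_trans->.
Qed.

End Retraction.

Section Subalgebra.
Variables (K : fieldType) (r : nat) (A : comNzRingType).
Variable theta : {rmorphism A -> {mpoly K[r]}}.
Hypothesis theta_inj : injective theta.
Hypothesis theta_const : forall c : K, exists a, theta a = c%:MP.

(** The elements along a chain of d + 1 primes would give d independent
    elements of a polynomial ring in r variables. *)
Lemma prime_chain_le d : has_prime_chain A d -> (d <= r)%N.
Proof.
case=> P /prime_chain_independent[x xP]; rewrite leqNgt; apply/negP => ltrd.
have [D [c [[a ca] rel]]] := mpoly_alg_dependent (theta \o x) ltrd.
have [h hE] := choice theta_const.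
case/eqP: ca; apply/eqP; rewrite -(mpolyC_eq0 r) -hE; apply/eqP.
rewrite [h _](xP D (h \o c)) ?rmorph0 // => [b|]; last first.
  apply: theta_inj; rewrite rmorph0 -rel rmorph_sum; apply: eq_bigr => b _ /=.
  rewrite rmorphM rmorph_prod hE mul_mpolyC; congr (_ *: _).
  by apply: eq_bigr => i _; rewrite rmorphXn.
have [cb0|cb0] := eqVneq (c b) 0; [left | right].
  by apply: theta_inj; rewrite /= hE cb0 !rmorph0.
exists (h (c b)^-1); apply: theta_inj.
by rewrite rmorphM /= !hE -rmorphM mulVf // !rmorph1.
Qed.

Hypothesis theta_keep : forall s, (s < r)%N ->
  exists x, keep K r s (theta x) = 0 /\ keep K r s.+1 (theta x) != 0.

(** The kernels of A -> K[X_0, ..., X_(s-1)] increase when s goes from r down to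
    0, and they are prime because a polynomial ring over a field is a domain. *)
Lemma prime_chain_keep : has_prime_chain A r.
Proof.
exists (fun i x => keep K r (r - i) (theta x) == 0); split=> [i|i j ltij].
  split; first split; rewrite /in_mem /= ?rmorph0 ?eqxx //.
    by rewrite !rmorph1 oner_eq0.
    move=> a u v; rewrite /in_mem /= => /eqP u0 /eqP v0.
    by rewrite 2!rmorphD 2!rmorphM /= u0 v0 mulr0 addr0.
  by move=> u v; rewrite /in_mem /= 2!rmorphM /= mulf_eq0.
rewrite /in_mem /=; split.
  move=> x; rewrite /in_mem /= => /eqP x0.
  by rewrite -(@keep_keep _ _ (r - j) (r - i)) ?leq_sub2l 1?ltnW // x0 rmorph0.
have lej := ltn_ord j; have [|x [x0 x1]] := theta_keep (s := r - j).
  by rewrite ltn_subrL; case: (i : nat) (j : nat) ltij lej => [|?] [|?] //; case: (r).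
exists x; rewrite /in_mem /= ?x0 //.
apply: contra x1 => /eqP x1.
rewrite -(@keep_keep _ _ _ (r - i)) ?x1 ?rmorph0 //.
by rewrite ltn_sub2l // (leq_trans ltij).
Qed.

Lemma max_chain_length_subalgebra : max_chain_length A r.
Proof. by split; [apply: prime_chain_keep | apply: prime_chain_le]. Qed.

End Subalgebra.

(** * Factoring a morphism through its kernel *)

Section QuotientMorphism.
Variables (R S : comNzRingType) (J : idealr R) (theta : {rmorphism R -> S}).

(** The condition on the kernel is an argument so that the morphism structure
    declared below can be inferred from the term itself. *)
Definition quot_morph of (forall x, (x \in J) = (theta x == 0)) :=
  fun x : {ideal_quot J} => theta (repr x) : S.

Hypothesis theta_ker : forall x, (x \in J) = (theta x == 0).
Local Notation qtheta := (quot_morph theta_ker).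

Lemma quot_morph_pi x : qtheta (\pi x) = theta x.
Proof.
apply/eqP; rewrite -subr_eq0 -rmorphB -theta_ker Quotient.idealrBE.
by rewrite reprK.
Qed.

Lemma quot_morph_is_zmod_morphism : zmod_morphism qtheta.
Proof.
move=> x y; rewrite -[x]reprK -[y]reprK -rmorphB !quot_morph_pi.
by rewrite rmorphB.
Qed.

Lemma quot_morph_is_monoid_morphism : monoid_morphism qtheta.
Proof.
split; first by rewrite -(rmorph1 \pi_({ideal_quot J})) quot_morph_pi rmorph1.
move=> x y; rewrite -[x]reprK -[y]reprK -rmorphM !quot_morph_pi.
by rewrite rmorphM.
Qed.

HB.instance Definition _ :=
  GRing.isZmodMorphism.Build {ideal_quot J} S qtheta
    quot_morph_is_zmod_morphism.
HB.instance Definition _ :=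
  GRing.isMonoidMorphism.Build {ideal_quot J} S qtheta
    quot_morph_is_monoid_morphism.

Lemma quot_morph_inj : injective qtheta.
Proof.
move=> x y; rewrite -[x]reprK -[y]reprK !quot_morph_pi => /eqP.
by rewrite -subr_eq0 -rmorphB -theta_ker Quotient.idealrBE => /eqP.
Qed.

End QuotientMorphism.

(** * The fiber cone of an ideal generated by monomials of the same degree *)

Lemma mpolyX_big (R : comNzRingType) n (T : finType) (F : T -> 'X_{1..n}) :
  \prod_t 'X_[F t] = 'X_[\sum_t F t] :> {mpoly R[n]}.
Proof. by rewrite -(big_morph _ (@mpolyXD n R) (mpolyX0 n R)). Qed.

Definition proj n r (f : 'I_r -> 'I_n) (w : 'X_{1..n}) : 'X_{1..r} :=
  [multinom w (f j) | j < r].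

(** For f injective, X_(f j) is sent to X_j T and every variable outside the range
    of f to T: the exponent of T records the total degree, which setting these
    variables to 1 would lose. Locked, like [initial], so that unification does
    not unfold it. *)
HB.lock Definition graded (K : fieldType) n r (f : 'I_r -> 'I_n) :
    {mpoly K[n]} -> {poly {mpoly K[r]}} :=
  mmap (@polyC {mpoly K[r]} \o @mpolyC r K)
    (fun i : 'I_n => ('X_[proj f U_(i)])%:P * 'X).

(** The coefficient of t^k in the result comes from the component of degree dk of
    the coefficient of t^k in p. *)
HB.lock Definition initial (K : fieldType) n r (f : 'I_r -> 'I_n) d
    (p : {poly {mpoly K[n]}}) : {poly {mpoly K[r]}} :=
  \poly_(k < size p) (graded f p`_k)`_(d * k).

Section Graded.
Variables (K : fieldType) (n r : nat) (f : 'I_r -> 'I_n).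
Notation gr := (@graded K n r f).

Lemma graded_is_zmod_morphism : zmod_morphism gr.
Proof. by rewrite unlock; apply: mmapB. Qed.

Lemma graded_is_monoid_morphism : monoid_morphism gr.
Proof. by rewrite unlock; split; [apply: rmorph1 | apply: rmorphM]. Qed.

HB.instance Definition _ :=
  GRing.isZmodMorphism.Build {mpoly K[n]} {poly {mpoly K[r]}} gr
    graded_is_zmod_morphism.
HB.instance Definition _ :=
  GRing.isMonoidMorphism.Build {mpoly K[n]} {poly {mpoly K[r]}} gr
    graded_is_monoid_morphism.

Lemma gradedX w : gr 'X_[w] = ('X_[proj f w])%:P * 'X^(mdeg w).
Proof.
rewrite unlock mmapX /mmap1.
rewrite (eq_bigr (fun i => ('X_[(proj f U_(i) *+ w i)%MM])%:P * 'X^(w i))).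
  rewrite big_split /= -(rmorph_prod (@polyC {mpoly K[r]})) /=.
  rewrite -expr_sum -mdegE mpolyX_big.
  congr (('X_[_])%:P * _); apply/mnmP => j; rewrite mnm_sumE mnmE.
  rewrite (bigD1 (f j)) //= mulmnE mnmE mnm1E eqxx mul1n big1 ?addn0 // => i ij.
  by rewrite mulmnE mnmE mnm1E (negPf ij).
by move=> i _; rewrite exprMn -rmorphXn /= mpolyXn.
Qed.

Lemma gradedC c : gr c%:MP = (c%:MP)%:P.
Proof. by rewrite unlock mmapC. Qed.

End Graded.

Section MonomialIdeal.
Variables (K : fieldType) (n m d r : nat) (v : 'I_m -> 'X_{1..n}).
Variable f : 'I_r -> 'I_n.
Notation S := {mpoly K[n]}.
Notation gr := (@graded K n r f).
Notation initial := (@initial K n r f d).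
Notation proj := (proj f).

Definition monomial_ideal : {pred S} :=
  gen_ideal [pred x : S | [exists i, x == 'X_[v i]]].

Notation I := monomial_ideal.

Definition comb (c : 'I_m -> nat) : 'X_{1..n} := (\sum_i v i *+ c i)%MM.

Hypothesis v_hom : forall i, mdeg (v i) = d.

(** I^k has no component of degree less than dk. This is what makes [initial]
    multiplicative on the Rees algebra. *)
Lemma graded_exp k x : x \in ideal_exp I k -> exists y, gr x = y * 'X^(d * k).
Proof.
elim: k x => [|k IHk] x /=; first by exists (gr x); rewrite muln0 mulr1.
move: x; apply: gen_ideal_sub => [||a x|y0].
- by exists 0; rewrite rmorph0 mul0r.
- move=> x y [x' xE] [y' yE]; exists (x' + y').
  by rewrite rmorphD /= xE yE mulrDl.
- by case=> y yE; exists (gr a * y); rewrite rmorphM /= yE mulrA.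
case/asboolP=> a aI [b /IHk[y yE] ->].
suff [z zE] : exists z, gr a = z * 'X^d.
  by exists (z * y); rewrite rmorphM /= zE yE mulnS exprD mulrACA.
move: a aI; apply: gen_ideal_sub => [||a x|z0].
- by exists 0; rewrite rmorph0 mul0r.
- move=> a b' [a' aE] [b'' bE]; exists (a' + b'').
  by rewrite rmorphD /= aE bE mulrDl.
- by case=> z zE; exists (gr a * z); rewrite rmorphM /= zE mulrA.
by case/existsP=> i /eqP->; exists ('X_[proj (v i)])%:P; rewrite gradedX v_hom.
Qed.

Lemma coef_initial p k : (initial p)`_k = (gr p`_k)`_(d * k).
Proof.
rewrite unlock coef_poly; case: ltnP => // lek.
by rewrite [p`_k]nth_default // rmorph0 coef0.
Qed.

Lemma initialB p q : initial (p - q) = initial p - initial q.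
Proof.
apply/polyP => k; rewrite coefB !coef_initial [(p - q)`_k]coefB.
by rewrite rmorphB coefB.
Qed.

Lemma initial1 : initial 1 = 1.
Proof.
apply/polyP => k; rewrite coef_initial !coef1; case: eqP => [->|_].
  by rewrite muln0 rmorph1 coef1.
by rewrite rmorph0 coef0.
Qed.

Lemma initialM p q : p \in rees_pred I -> q \in rees_pred I ->
  initial (p * q) = initial p * initial q.
Proof.
move=> /asboolP pI /asboolP qI; apply/polyP => k.
rewrite coef_initial !coefM rmorph_sum coef_sum; apply: eq_bigr => i _.
rewrite !coef_initial rmorphM /=.
have [x ->] := graded_exp (pI i); have [y ->] := graded_exp (qI (k - i)%N).
rewrite mulrACA -exprD -mulnDr subnKC -1?ltnS // !coefMXn !ltnn !subnn.
by rewrite coefM big_ord1.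
Qed.

(** On the fiber cone this induces the isomorphism to the monomial algebra followed
    by the projection [proj] of exponents; t is set to 1 because the degree
    already determines its exponent. The hypothesis on the degrees is an argument
    so that the morphism structure can be inferred. *)
Definition initial_eval of (forall i, mdeg (v i) = d) :=
  fun x : rees I => (initial (val x)).[1] : {mpoly K[r]}.
Notation fiber_morph := (initial_eval v_hom).

Lemma fiber_morph_is_zmod_morphism : zmod_morphism fiber_morph.
Proof. by move=> x y; rewrite /initial_eval rmorphB initialB hornerD hornerN. Qed.

Lemma fiber_morph_is_monoid_morphism : monoid_morphism fiber_morph.
Proof.
split; first by rewrite /initial_eval rmorph1 initial1 hornerC.
by move=> x y; rewrite /initial_eval rmorphM (initialM (valP x) (valP y)) hornerM.
Qed.

HB.instance Definition _ :=
  GRing.isZmodMorphism.Build (rees I) {mpoly K[r]} fiber_morph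
    fiber_morph_is_zmod_morphism.
HB.instance Definition _ :=
  GRing.isMonoidMorphism.Build (rees I) {mpoly K[r]} fiber_morph
    fiber_morph_is_monoid_morphism.

Lemma fiber_morph_homog (x : rees I) a k :
  val x = a%:P * 'X^k -> fiber_morph x = (gr a)`_(d * k).
Proof.
move=> xE; rewrite /initial_eval.
suff -> : initial (val x) = ((gr a)`_(d * k))%:P * 'X^k by rewrite !hornerE expr1n mulr1.
apply/polyP => j; rewrite coef_initial xE !coefCM !coefXn.
by have [->|_] := eqVneq j k; rewrite ?mulr1 ?mulr0 // rmorph0 coef0.
Qed.

(** Multiplying by a variable raises the degree, so nothing of degree dk is left. *)
Lemma fiber_morph_fiber (x : rees I) : x \in @fiber_ideal K n I -> fiber_morph x = 0.
Proof.
move: x; apply: gen_ideal_sub => [|x y x0 y0|a x x0|x].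
- exact: rmorph0.
- by rewrite rmorphD /= x0 y0 addr0.
- by rewrite rmorphM /= x0 mulr0.
case/asboolP=> a aI xE; rewrite (@fiber_morph_homog x a 0) ?mulr1 // muln0.
move: a aI {x xE}; apply: gen_ideal_sub => [|x y x0 y0|a x x0|z].
- by rewrite rmorph0 coef0.
- by rewrite rmorphD coefD /= x0 y0 addr0.
- by rewrite rmorphM coefM big_ord1 /= x0 mulr0.
by case/existsP=> i /eqP->; rewrite gradedX mdeg1 coefMX.
Qed.

Lemma mem_rees_homog a k : a \in ideal_exp I k -> a%:P * 'X^k \in rees_pred I.
Proof.
move=> aI; apply/asboolP => j; rewrite coefCM coefXn.
by have [->|_] := eqVneq j k; rewrite ?mulr1 // mulr0 ideal_exp0.
Qed.

Lemma mem_exp_comb c : 'X_[comb c] \in ideal_exp I (\sum_i c i).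
Proof.
rewrite /comb -mpolyX_big.
elim/big_rec2: _ => [//|i k x _ xI]; apply: ideal_expM => //.
rewrite -mpolyXn; elim: (c i) => [//|l IHl]; rewrite exprS /=.
apply: mem_gen_ideal; apply/asboolP; exists 'X_[v i].
  by apply: mem_gen_ideal; apply/existsP; exists i.
by exists ('X_[v i] ^+ l).
Qed.

Definition rees_comb c : rees I := Rees (mem_rees_homog (mem_exp_comb c)).

Lemma mem_rees_cst a : a%:P \in rees_pred I.
Proof. by rewrite -[_%:P]mulr1; apply: (@mem_rees_homog a 0). Qed.

Definition rees_cst a : rees I := Rees (mem_rees_cst a).

Definition rees_sum (s : seq (S * ('I_m -> nat))) : rees I :=
  \sum_(p <- s) rees_cst p.1 * rees_comb p.2.

Lemma ideal_exp_comb k x : x \in ideal_exp I k ->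
  exists2 s : seq (S * ('I_m -> nat)),
    {in s, forall p, (\sum_i p.2 i)%N = k} & x = \sum_(p <- s) p.1 * 'X_[comb p.2].
Proof.
elim: k x => [|k IHk] x.
  move=> _; exists [:: (x, fun=> 0%N)] => [p|].
    by rewrite inE => /eqP->; rewrite big1.
  by rewrite big_seq1 /= /comb big1 ?mpolyX0 ?mulr1.
move: x; apply: gen_ideal_sub => [|_ _ [s sk ->] [t tk ->]|a _ [s sk ->]|z].
- by exists [::]; rewrite ?big_nil.
- exists (s ++ t); last by rewrite big_cat.
  by move=> p; rewrite mem_cat => /orP[/sk|/tk].
- exists [seq (a * p.1, p.2) | p <- s]; first by move=> _ /mapP[p /sk <- ->].
  by rewrite big_map mulr_sumr; apply: eq_bigr => p _ /=; rewrite mulrA.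
case/asboolP=> a aI [b /IHk[t tk ->] ->] {b}.
move: a aI; apply: gen_ideal_sub => [|a b [s sk sE] [s' sk' sE']|a x [s sk sE]|z'].
- by exists [::]; rewrite ?big_nil ?mul0r.
- exists (s ++ s'); last by rewrite big_cat mulrDl sE sE'.
  by move=> p; rewrite mem_cat => /orP[/sk|/sk'].
- exists [seq (a * p.1, p.2) | p <- s]; first by move=> _ /mapP[p /sk <- ->].
  rewrite -mulrA sE big_map mulr_sumr; apply: eq_bigr => p _ /=.
  by rewrite mulrA.
case/existsP=> i /eqP->.
exists [seq (p.1, fun j => (p.2 j + (i == j))%N) | p <- t].
  move=> _ /mapP[p /tk <- ->] /=; rewrite big_split /=.
  rewrite [X in (_ + X)%N](bigD1 i) //= eqxx [X in (true + X)%N]big1 ?addn1 // => j.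
  by rewrite eq_sym => /negPf->.
rewrite mulr_sumr big_map; apply: eq_bigr => p _ /=.
rewrite mulrCA -mpolyXD; congr (_ * 'X_[_]); rewrite /comb.
apply/mnmP => j; rewrite mnmDE !mnm_sumE (bigD1 i) //= [in RHS](bigD1 i) //=.
rewrite !mulmnE eqxx mulnDr muln1 addnA; congr (_ + _)%N; first by rewrite addnC.
by apply: eq_bigr => l li; rewrite !mulmnE eq_sym (negPf li) addn0.
Qed.

(** The products of generators span the Rees algebra over the polynomial ring,
    and, by [rees_sum_cst], the fiber cone over the field. *)
Lemma rees_combE (x : rees I) : exists s, x = rees_sum s.
Proof.
have coefE k : exists s : seq (S * ('I_m -> nat)),
    {in s, forall p, (\sum_i p.2 i)%N = k} /\
    (val x)`_k = \sum_(p <- s) p.1 * 'X_[comb p.2].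
  by have /asboolP/(_ k)/ideal_exp_comb[s sk sE] := valP x; exists s.
have [P PE] := choice coefE.
exists (flatten [seq P k | k <- iota 0 (size (val x))]).
apply: val_inj; rewrite /rees_sum raddf_sum /= big_flatten big_map.
rewrite -[LHS]coefK poly_def -(big_mkord xpredT (fun i => (val x)`_i *: 'X^i)).
rewrite /index_iota subn0; apply: eq_bigr => k _.
have [sk ->] := PE k; rewrite scaler_suml big_seq [RHS]big_seq.
apply: eq_bigr => p /sk <-; rewrite mulrA -polyCM.
by rewrite mul_polyC.
Qed.

Lemma irrelevant_subC (a : S) : a - (a@_0)%:MP \in @irrelevant_ideal K n.
Proof.
elim/mpolyind: a => [|c w a _ _ IHa]; first by rewrite mcoeff0 subr0 gen_ideal0.
rewrite mcoeffD mpolyCD opprD addrACA gen_idealD // mcoeffZ mcoeffX.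
have [->|w0] := eqVneq w 0%MM.
  by rewrite mulr1 mpolyX0 -mul_mpolyC mulr1 subrr gen_ideal0.
rewrite mulr0 subr0 -mul_mpolyC; apply: gen_idealM.
have [i wi] : exists i, w i != 0%N.
  apply/existsP; rewrite -negb_forall; apply: contra w0 => /forallP w0.
  by apply/eqP/mnmP => i; rewrite mnm0E; apply/eqP.
rewrite -(@submK _ U_(i) w); last by rewrite lep1mP.
rewrite mpolyXD; apply: gen_idealM; apply: mem_gen_ideal.
by apply/existsP; exists i.
Qed.

Definition cst_sum (s : seq (S * ('I_m -> nat))) :=
  [seq ((p.1@_0)%:MP, p.2) | p <- s] : seq (S * ('I_m -> nat)).

Lemma rees_sum_cst s : rees_sum s - rees_sum (cst_sum s) \in @fiber_ideal K n I.
Proof.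
rewrite /rees_sum big_map -sumrB; apply: (big_ind (fun x => x \in @fiber_ideal K n I)).
- exact: gen_ideal0.
- exact: gen_idealD.
move=> p _ /=; rewrite -mulrBl mulrC; apply: gen_idealM; apply: mem_gen_ideal.
apply/asboolP; exists (p.1 - (p.1@_0)%:MP); first exact: irrelevant_subC.
by rewrite rmorphB /= polyCB.
Qed.

Lemma mdeg_comb c : mdeg (comb c) = (d * \sum_i c i)%N.
Proof.
rewrite mdeg_sum big_distrr; apply: eq_bigr => i _.
by rewrite mdegMn v_hom.
Qed.

Lemma fiber_morph_cst a : fiber_morph (rees_cst a%:MP) = a%:MP.
Proof.
rewrite (@fiber_morph_homog _ a%:MP 0) /= ?mulr1 //.
by rewrite gradedC muln0 coefC.
Qed.

Lemma fiber_morph_comb c : fiber_morph (rees_comb c) = 'X_[proj (comb c)].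
Proof.
rewrite (@fiber_morph_homog _ 'X_[comb c] (\sum_i c i)) // gradedX mdeg_comb.
by rewrite coefMXn ltnn subnn coefC.
Qed.

Hypothesis d_gt0 : (0 < d)%N.
Hypothesis proj_comb : forall c c',
  proj (comb c) = proj (comb c') -> comb c = comb c'.

(** By [rees_sum_cst] it suffices to treat combinations over K of products of
    generators. The morphism sends such a product to the monomial of the
    projected exponent, which by [proj_comb] determines the exponent, hence also
    the number of factors, because d > 0. So the coefficients of the combination
    can be read off its image. *)
Lemma fiber_morph_ker x : (x \in @fiber_ideal K n I) = (fiber_morph x == 0).
Proof.
apply/idP/eqP => [|x0]; first exact: fiber_morph_fiber.
have [s xs] := rees_combE x.
suff y0 : rees_sum (cst_sum s) = 0 by rewrite xs -[rees_sum s]subr0 -y0 rees_sum_cst.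
have: fiber_morph (rees_sum (cst_sum s)) = 0.
  have := fiber_morph_fiber (rees_sum_cst s).
  by rewrite -xs rmorphB /= x0 sub0r => /eqP; rewrite oppr_eq0 => /eqP.
rewrite /rees_sum big_map rmorph_sum /=.
rewrite (eq_bigr (fun p => p.1@_0%MM *: 'X_[proj (comb p.2)])); last first.
  by move=> p _; rewrite rmorphM /= fiber_morph_cst fiber_morph_comb mul_mpolyC.
move=> sum0; apply: val_inj; apply/polyP => k; apply/mpolyP => w.
rewrite raddf_sum coef_sum raddf_sum rmorph0 coef0 mcoeff0 /=.
rewrite (eq_bigr (fun p : S * ('I_m -> nat) => p.1@_0%MM *
   ((k == \sum_i p.2 i)%N && (comb p.2 == w))%:R)); last first.
  move=> p _; rewrite /= !coefCM coefXn mcoeffCM.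
  by case: eqP => _; rewrite ?mulr1 ?mcoeffX // mulr0 mcoeff0.
have [/hasP[p0 sp0 /andP[/eqP kE /eqP wE]]|/hasPn s0] :=
    boolP (has (fun p : S * ('I_m -> nat) => (k == \sum_i p.2 i)%N && (comb p.2 == w)) s);
  last first.
  by rewrite big_seq big1 // => p /s0/negPf->; rewrite mulr0.
have := congr1 (mcoeff (proj w)) sum0; rewrite raddf_sum /= mcoeff0 => sum0w.
rewrite -[RHS]sum0w; apply: eq_bigr => p _; rewrite mcoeffZ mcoeffX; congr (_ * _%:R).
rewrite -wE; congr nat_of_bool; apply/andP/eqP => [[_ /eqP->] //|/proj_comb pE].
split; last by rewrite pE.
by rewrite -(eqn_pmul2l d_gt0) kE -!mdeg_comb pE.
Qed.

End MonomialIdeal.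

Arguments monomial_ideal K [n m] v.

(** * The analytic spread as a rank *)

Section Rank.
Variables (K : fieldType) (n m d : nat) (v : 'I_m -> 'X_{1..n}).

Definition exponent_mx : 'M[rat]_(m, n) := \matrix_(i, j) (v i j)%:R.

(** The positive and negative parts of the numerators over a common
    denominator. *)
Lemma clear_denominators (u : 'I_m -> rat) : exists (q : rat) (c c' : 'I_m -> nat),
  q != 0 /\ forall i, u i * q = (c i)%:R - (c' i)%:R.
Proof.
pose q : rat := \prod_i (denq (u i))%:~R.
have uz i : exists p : nat * nat, u i * q = p.1%:R - p.2%:R.
  have [z ->] : exists z : int, u i * q = z%:~R.
    exists (numq (u i) * \prod_(j | j != i) denq (u j)).
    rewrite /q (bigD1 i) //= mulrA -{1}[u i]divq_num_den divfK ?intr_eq0 ?denq_neq0 //.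
    by rewrite rmorphM rmorph_prod.
  case: z => [z|z]; [exists (z, 0%N) | exists (0%N, z.+1)] => /=.
    by rewrite subr0.
  by rewrite NegzE sub0r rmorphN.
have [p pE] := choice uz.
exists q, (fst \o p), (snd \o p); split; last exact: pE.
by apply/prodf_neq0 => i _; rewrite intr_eq0 denq_neq0.
Qed.

Lemma exponent_mx_comb (c : 'I_m -> nat) j :
  ((\row_i (c i)%:R) *m exponent_mx) 0 j = (comb v c j)%:R.
Proof.
rewrite mxE /comb mnm_sumE natr_sum; apply: eq_bigr => i _.
by rewrite !mxE mulmnE natrM mulrC.
Qed.

Hypothesis v_hom : forall i, mdeg (v i) = d.
Hypothesis d_gt0 : (0 < d)%N.

Notation cone := {ideal_quot (@fiber_ideal K n (monomial_ideal K v))}.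

(** The r chosen columns of M form a matrix N of the same rank: as M = N D, the
    projection to these columns is injective on combinations of rows, and as N
    has full row space, each vector of the standard basis is, up to a scalar, a
    difference of two such projections. *)
Lemma analytic_spread_monomial :
  analytic_spread (monomial_ideal K v) = (\rank exponent_mx)%:E.
Proof.
set M := exponent_mx; rewrite -mxrank_tr; set r := \rank M^T.
pose f : 'I_r -> 'I_n := maxrankfun M^T.
pose N := colsub f M.
have N_full : row_full N.
  by rewrite /row_full -mxrank_tr /N trmx_mxsub; apply: maxrowsub_free.
have [D DE] : exists D, M = N *m D.
  have /submxP[D DE] : (M^T <= rowsub f M^T)%MS by rewrite eq_maxrowsub.
  by exists D^T; rewrite -[LHS]trmxK DE trmx_mul trmx_mxsub trmxK.
have NE (c : 'I_m -> nat) j : ((\row_i (c i)%:R) *m N) 0 j = (proj f (comb v c) j)%:R.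
  by rewrite /N mulmx_colsub [LHS]mxE exponent_mx_comb mnmE.
have proj_comb c c' :
    proj f (comb v c) = proj f (comb v c') -> comb v c = comb v c'.
  move=> cc'; apply/mnmP => j; apply/eqP; rewrite -(eqr_nat rat).
  rewrite -!exponent_mx_comb -/M DE !mulmxA; apply/eqP; congr ((_ *m _) _ _).
  by apply/rowP => l; rewrite !NE cc'.
apply: krull_dimE.
pose theta : {rmorphism cone -> {mpoly K[r]}} :=
  quot_morph (J := @fiber_ideal K n (monomial_ideal K v))
   (fiber_morph_ker v_hom d_gt0 proj_comb).
have thetaE x : theta (\pi_(cone) x) = initial_eval f v_hom x.
  exact: quot_morph_pi.
apply: (@max_chain_length_subalgebra _ _ _ theta).
- exact: quot_morph_inj.
- by move=> c; exists (\pi_(cone) (rees_cst v c%:MP)); rewrite thetaE fiber_morph_cst.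
move=> s ltsr; pose J := Ordinal ltsr.
have /submxP[u uE] := submx_full (delta_mx 0 J : 'rV_r) N_full.
have [q [c [c' [q0 cE]]]] := clear_denominators (u 0).
have diff j : (proj f (comb v c) j)%:R - (proj f (comb v c') j)%:R = q *+ (j == J) :> rat.
  have: q *: u = \row_i (c i)%:R - \row_i (c' i)%:R.
    by apply/rowP => i; rewrite !mxE mulrC.
  move/(congr1 (fun w : 'rV_m => (w *m N) 0 j)).
  rewrite mulmxBl -scalemxAl -uE => /esym; rewrite [LHS]mxE [X in _ + X = _]mxE !NE => ->.
  by rewrite !mxE eqxx /= mulr_natr.
exists (\pi_(cone) (rees_comb K v c - rees_comb K v c')).
rewrite thetaE rmorphB /= !fiber_morph_comb // !rmorphB /= !keepX.
split.
  apply/eqP; rewrite subr_eq0; apply/eqP; congr 'X_[_]; apply/mnmP => j.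
  rewrite !mnmE; case: ifP => // ltjs; apply/eqP; rewrite -(eqr_nat rat) -subr_eq0.
  by have := diff j; rewrite !mnmE => ->; rewrite (_ : j == J = false) // -val_eqE ltn_eqF.
apply/negP => /eqP/(congr1 (mcoeff (keep_mnm s.+1 (proj f (comb v c))))).
rewrite mcoeffB !mcoeffX eqxx mcoeff0; case: eqP => [/mnmP/(_ J)|_ /eqP]; last first.
  by rewrite subr0 oner_eq0.
rewrite !mnmE /= ltnSn => eqJ; have := diff J.
by rewrite !mnmE eqJ subrr eqxx => /esym/eqP; rewrite (negPf q0).
Qed.

End Rank.

(** * Incidence matrices of graphs *)

Section Graph.
Variables (n : nat) (e : rel 'I_n).
Hypotheses (e_sym : symmetric e) (e_irr : irreflexive e).

Notation edge := [pred p : 'I_n * 'I_n | e p.1 p.2].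
Notation m := #|edge|.

(** Each edge is indexed twice, once for each orientation; this changes neither
    the ideals nor the ranks. *)
Definition edge_end1 (k : 'I_m) : 'I_n := (enum_val k).1.
Definition edge_end2 (k : 'I_m) : 'I_n := (enum_val k).2.

Definition edge_mnm (k : 'I_m) : 'X_{1..n} :=
  (U_(edge_end1 k) + U_(edge_end2 k))%MM.

Definition comp_edge_mnm (k : 'I_m) : 'X_{1..n} :=
  [multinom nat_of_bool ((l != edge_end1 k) && (l != edge_end2 k)) | l < n].

Lemma edge_endsP k : e (edge_end1 k) (edge_end2 k).
Proof. exact: (enum_valP k). Qed.

Lemma edge_end_neq k : edge_end1 k != edge_end2 k.
Proof. by apply: contraTneq (edge_endsP k) => ->; rewrite e_irr. Qed.

Lemma edge_endsE i j : e i j -> exists k, edge_end1 k = i /\ edge_end2 k = j.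
Proof.
move=> eij; have Eij : (i, j) \in edge by [].
by exists (enum_rank_in Eij (i, j)); rewrite /edge_end1 /edge_end2 enum_rankK_in.
Qed.

Lemma edge_idealE (K : fieldType) : edge_ideal K e = monomial_ideal K edge_mnm.
Proof.
congr gen_ideal; apply/funext => x; apply/existsP/existsP.
  case=> i /existsP[j /andP[/edge_endsE[k [<- <-]] /eqP->]]; exists k.
  by rewrite mpolyXD.
case=> k /eqP->; exists (edge_end1 k); apply/existsP; exists (edge_end2 k).
by rewrite edge_endsP mpolyXD eqxx.
Qed.

Lemma comp_edge_mnmX (K : fieldType) k :
  'X_[comp_edge_mnm k] =
    \prod_(l | (l != edge_end1 k) && (l != edge_end2 k)) 'X_l :> {mpoly K[n]}.
Proof.
rewrite mpolyXE_id [RHS]big_mkcond; apply: eq_bigr => l _.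
by rewrite mnmE; case: ifP => _; rewrite ?expr1 ?expr0.
Qed.

Lemma comp_edge_idealE (K : fieldType) :
  comp_edge_ideal K e = monomial_ideal K comp_edge_mnm.
Proof.
congr gen_ideal; apply/funext => x; apply/existsP/existsP.
  case=> i /existsP[j /andP[/edge_endsE[k [<- <-]] /eqP->]]; exists k.
  by rewrite comp_edge_mnmX.
case=> k /eqP->; exists (edge_end1 k); apply/existsP; exists (edge_end2 k).
by rewrite edge_endsP comp_edge_mnmX eqxx.
Qed.

Lemma mdeg_edge_mnm k : mdeg (edge_mnm k) = 2%N.
Proof. by rewrite mdegD !mdeg1. Qed.

Lemma mdeg_comp_edge_mnm k : mdeg (comp_edge_mnm k) = (n - 2)%N.
Proof.
have -> : (n - 2)%N = #|~: [set edge_end1 k; edge_end2 k]|.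
  by rewrite cardsCs setCK cards2 edge_end_neq card_ord.
rewrite mdegE -sum1_card [RHS]big_mkcond; apply: eq_bigr => l _ /=.
by rewrite mnmE !inE negb_or; case: (_ && _).
Qed.

Notation M := (exponent_mx edge_mnm).
Notation M' := (exponent_mx comp_edge_mnm).
Notation J := (const_mx 1 : 'M[rat]_n).

Lemma exponent_mx_edge k l :
  M k l = (edge_end1 k == l)%:R + (edge_end2 k == l)%:R.
Proof. by rewrite mxE mnmDE !mnm1E natrD. Qed.

(** This uses that G has no loop: the entries of a row at its two distinct ends
    are 1. *)
Lemma exponent_mx_comp_edge : M' = const_mx 1 - M.
Proof.
apply/matrixP => k l; rewrite [RHS]mxE [in RHS]mxE [in X in _ + X]mxE exponent_mx_edge.
rewrite !mxE mnmE ![l == _]eq_sym.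
have [<-|_] /= := eqVneq (edge_end1 k) l; last by rewrite add0r; case: eqP.
by rewrite eq_sym (negPf (edge_end_neq k)) addr0 subrr.
Qed.

Lemma exponent_mx_mulJ p d (v : 'I_p -> 'X_{1..n}) :
  (forall k, mdeg (v k) = d) -> exponent_mx v *m J = const_mx d%:R.
Proof.
move=> vd; apply/matrixP => k l; rewrite !mxE -(vd k) mdegE natr_sum.
by apply: eq_bigr => i _; rewrite !mxE mulr1.
Qed.

(** The complement 1 - V is V (d^-1 J - 1), where J is the all-one matrix. *)
Lemma rank_le_complement p d (v v' : 'I_p -> 'X_{1..n}) : (0 < d)%N ->
  (forall k, mdeg (v k) = d) ->
  exponent_mx v' = const_mx 1 - exponent_mx v ->
  (\rank (exponent_mx v') <= \rank (exponent_mx v))%N.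
Proof.
move=> d0 vd ->; have -> : const_mx 1 - exponent_mx v =
    exponent_mx v *m (d%:R^-1 *: J - 1%:M).
  rewrite mulmxBr mulmx1 -scalemxAr (exponent_mx_mulJ vd); congr (_ - _).
  by apply/matrixP => i j; rewrite !mxE mulVf // pnatr_eq0 -lt0n.
exact: mxrankM_maxl.
Qed.

Lemma rank_comp_edge : (3 <= n)%N -> \rank M' = \rank M.
Proof.
move=> n3; apply/eqP; rewrite eqn_leq; apply/andP; split.
  exact: (rank_le_complement _ mdeg_edge_mnm exponent_mx_comp_edge).
apply: (rank_le_complement _ mdeg_comp_edge_mnm); first by rewrite subn_gt0.
by rewrite exponent_mx_comp_edge opprB addrC subrK.
Qed.

Notation comp x := [set y | connect e x y].

(** One vertex in each bipartite component. *)
Definition bip_roots : {set 'I_n} :=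
  [set x | (fingraph.root e x == x) && bipartite_on e (comp x)].

Lemma bip_rootsP x y : x \in bip_roots -> y \in bip_roots -> connect e x y -> x = y.
Proof.
rewrite !inE => /andP[/eqP rx _] /andP[/eqP ry _].
by move/(fingraph.rootP (sym_connect_sym e_sym)); rewrite rx ry.
Qed.

Lemma card_bip_roots : #|bip_roots| = nb_bipartite_components e.
Proof.
rewrite /nb_bipartite_components.
have -> : [set C in components e | bipartite_on e C] = (fun x => comp x) @: bip_roots.
  apply/setP => C; rewrite inE; apply/andP/imsetP.
    case=> /imsetP[x _ ->]; have -> : [set y in setT | connect e x y] = comp x.
      by apply/setP => y; rewrite !inE.
    have -> : comp x = comp (fingraph.root e x).
      apply/setP => y; rewrite !inE; apply: same_connect (connect_root _ _) _.
      exact: sym_connect_sym.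
    move=> bx; exists (fingraph.root e x) => //; rewrite inE bx andbT.
    by rewrite root_root //; apply: sym_connect_sym.
  case=> x; rewrite inE => /andP[_ bx] ->; split=> //; apply/imsetP; exists x => //.
  by apply/setP => y; rewrite !inE.
rewrite card_in_imset // => x y xR yR /setP/(_ y); rewrite !inE connect0.
exact: bip_rootsP.
Qed.

Notation r := #|~: bip_roots|.
Notation nonroot := (fun j : 'I_r => enum_val j : 'I_n).

Lemma connect_invariant T (h : 'I_n -> T) x y :
  (forall i j, e i j -> h i = h j) -> connect e x y -> h x = h y.
Proof.
move=> he /connectP[p pth ->]; elim: p x pth => //= z p IHp x /andP[/he-> /IHp].
by [].
Qed.

(** As x changes sign along edges, its square is constant on each component. If it is nonzero on one, its
    sign is a proper 2-colouring, so the component is bipartite and has a root,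
    where x vanishes. *)
Lemma edge_antisym_eq0 (x : 'I_n -> rat) :
    (forall i j, e i j -> x i = - x j) -> (forall i, i \in bip_roots -> x i = 0) ->
  forall i, x i = 0.
Proof.
move=> xe xR i; apply/eqP; apply: contraT => xi.
have x2 j l : connect e j l -> x j ^+ 2 = x l ^+ 2.
  by apply: (connect_invariant (h := fun i => x i ^+ 2)) => a b /xe->; rewrite sqrrN.
have ci := connect_root e i; set rt := fingraph.root e i in ci.
suff: x rt = 0 by move=> xr; rewrite -sqrf_eq0 (x2 _ _ ci) xr expr0n eqxx in xi.
apply: xR; rewrite inE root_root ?eqxx /=; last exact: sym_connect_sym.
apply/existsP; exists [set j | 0 < x j].
apply/forall_inP => j jC; apply/forall_inP => l lC; apply/implyP => ejl.
rewrite !inE (xe _ _ ejl) oppr_gt0.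
have: x l != 0.
  rewrite inE in lC; rewrite -sqrf_eq0 -(x2 _ _ lC) -(x2 _ _ ci) sqrf_eq0 //.
by case: ltgtP.
Qed.

(** With signs s_z given by a 2-colouring of the component of a root l, each row
    of M, hence also w, is orthogonal to s. As l is the only vertex of the
    component where w may be nonzero, it vanishes there too. *)
Lemma edge_span_eq0 (w : 'rV[rat]_n) :
    (w <= M)%MS -> (forall i, i \notin bip_roots -> w 0 i = 0) -> w = 0.
Proof.
case/submxP=> u wE w0; apply/rowP => l; rewrite mxE.
have [lR|/w0//] := boolP (l \in bip_roots).
have: bipartite_on e (comp l) by move: lR; rewrite inE => /andP[].
case/existsP=> A /forall_inP Abip.
pose s z : rat := if connect e l z then (-1) ^+ (z \in A) else 0.
have sE i j : e i j -> s i + s j = 0.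
  move=> eij; rewrite /s.
  have -> : connect e l j = connect e l i.
    by apply/esym/same_connect_r/connect1 => //; apply: sym_connect_sym.
  case: ifP => li; last by rewrite addr0.
  have lj : connect e l j := connect_trans li (connect1 eij).
  have := Abip i; rewrite inE li => /(_ isT)/forall_inP/(_ j).
  by rewrite inE lj eij => /(_ isT); do 2!case: (_ \in A).
have: \sum_z w 0 z * s z = 0.
  pose sv : 'cV_n := \col_z s z.
  have -> : \sum_z w 0 z * s z = (w *m sv) 0 0.
    by rewrite mxE; apply: eq_bigr => z _; rewrite mxE.
  have pick a : \sum_z (a == z)%:R * s z = s a.
    rewrite (bigD1 a) //= eqxx mul1r big1 ?addr0 // => z.
    by rewrite eq_sym => /negPf->; rewrite mul0r.
  rewrite wE -mulmxA (_ : M *m sv = 0) ?mulmx0 ?mxE //.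
  apply/colP => k; rewrite [RHS]mxE -(sE _ _ (edge_endsP k)) mxE.
  under eq_bigr => z _ do rewrite exponent_mx_edge mxE mulrDl.
  by rewrite big_split /= !pick.
rewrite (bigD1 l) //= big1 ?addr0 => [/eqP|z zl].
  rewrite mulf_eq0 /s connect0 signr_eq0 orbF => /eqP->//.
rewrite /s; case: ifP => lz; last by rewrite mulr0.
rewrite w0 ?mul0r //; apply: contra zl => zR.
by rewrite (bip_rootsP lR zR lz).
Qed.

(** The columns outside the roots are independent by [edge_antisym_eq0], and they
    carry the whole rank because by [edge_span_eq0] a combination of rows that
    vanishes on them is zero. *)
Lemma rank_edge : \rank M = (n - nb_bipartite_components e)%N.
Proof.
have -> : (n - nb_bipartite_components e)%N = r.
  by rewrite -card_bip_roots [RHS]cardsCs setCK card_ord.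
pose N := colsub nonroot M.
have <- : \rank N = r.
  rewrite -mxrank_tr; apply/eqP/inj_row_free => y yN.
  pose x i : rat := \sum_(j | nonroot j == i) y 0 j.
  have x0 i : x i = 0.
    apply: edge_antisym_eq0 i => [i j eij|i iR].
      apply/eqP; rewrite -subr_eq0 opprK; have [k [<- <-]] := edge_endsE eij.
      have := congr1 (fun z : 'rV_ _ => z 0 k) yN; rewrite !mxE => <-.
      rewrite /x big_mkcond [X in _ + X]big_mkcond -big_split /=.
      apply/eqP; apply: eq_bigr => j' _; rewrite 2!mxE exponent_mx_edge.
      rewrite mulrDr !mulr_natr !mulrb ![nonroot _ == _]eq_sym; congr (_ + _); by rewrite eq_sym.
    rewrite /x big1 // => j /eqP ji; have := enum_valP j; rewrite inE ji iR.
    by [].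
  apply/rowP => j; rewrite mxE -[RHS](x0 (enum_val j)) /x (big_pred1 j) // => l.
  by rewrite (inj_eq enum_val_inj).
have NM : N = M *m colsub nonroot 1%:M by rewrite mulmx_colsub mulmx1.
apply/eqP; rewrite eqn_leq; apply/andP; split; last by rewrite NM mxrankM_maxl.
suff /mxrankS : (kermx N <= kermx M)%MS.
  by rewrite !mxrank_ker leq_sub2lE ?rank_leq_row.
apply/rV_subP => u /sub_kermxP uN; apply/sub_kermxP.
apply: edge_span_eq0 => [|i iR]; first exact: submxMl.
have iR' : i \in ~: bip_roots by rewrite inE.
have := congr1 (fun z : 'rV_ _ => z 0 (enum_rank_in iR' i)) uN.
by rewrite /N mulmx_colsub !mxE enum_rankK_in.
Qed.

End Graph.

Theorem corollary3p2 (K : fieldType) (n : nat) (e : rel 'I_n)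
    (e_sym : symmetric e) (e_irr : irreflexive e) (n_ge3 : (3 <= n)%N) :
  analytic_spread (comp_edge_ideal K e) = analytic_spread (edge_ideal K e) /\
  analytic_spread (edge_ideal K e) = ((n - nb_bipartite_components e)%N)%:E.
Proof.
have edgeE : analytic_spread (edge_ideal K e) = (n - nb_bipartite_components e)%N%:E.
  rewrite edge_idealE (analytic_spread_monomial K (@mdeg_edge_mnm n e)) //.
  by rewrite rank_edge.
split; last exact: edgeE.
rewrite edgeE comp_edge_idealE.
rewrite (analytic_spread_monomial K (mdeg_comp_edge_mnm e_irr)) ?subn_gt0 //.
by rewrite rank_comp_edge // rank_edge.
Qed.
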